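(* For every integer $n\ge 0$, \[ \sum_{k=0}^{\infty}(-1)^{\lceil k/2\rceil}\,\overline{p}_o\!\left(n-\frac{k(k+1)}{2}\right)=\sum_{k=-\infty}^{\infty}(-1)^k\,p_d\bigl(n-k(3k+1)\bigr). \]
   Context: $\overline{p}_o(n)$ is the number of overpartitions of $n$ into odd parts (partitions into odd parts in which the first occurrence of each part size may be overlined), with $\sum_{n\ge0}\overline{p}_o(n)q^n=\frac{(-q;q^2)_\infty}{(q;q^2)_\infty}$, where $(a;q)_\infty=\prod_{k\ge1}(1-aq^{k-1})$. $p_d(n)$ is the number of partitions of $n$ into distinct parts, $\sum_{n\ge0}p_d(n)q^n=(-q;q)_\infty$. Convention: these functions vanish at arguments that are not nonnegative integers. *)

(* Defs.v *)
From HB Require Import structures.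
From mathcomp Require Import all_boot all_order all_algebra.
From mathcomp Require Import boolp classical_sets cardinality fsbigop.

Set Implicit Arguments.
Unset Strict Implicit.
Unset Printing Implicit Defensive.

Import GRing.Theory Num.Theory.

(* A partition of [n] is encoded by its multiplicities: [m i] is the number of
   times the part [i] occurs.  Parts and multiplicities of a partition of [n]
   are at most [n], so the bounds [n.+1] lose nothing. *)
Definition is_partition (n : nat) (m : {ffun 'I_n.+1 -> 'I_n.+1}) : bool :=
  (m ord0 == ord0) && (\sum_(i < n.+1) i * m i == n)%N.

Definition has_distinct_parts (n : nat) (m : {ffun 'I_n.+1 -> 'I_n.+1}) : bool :=
  [forall i, m i <= 1]%N.

Definition has_odd_parts (n : nat) (m : {ffun 'I_n.+1 -> 'I_n.+1}) : bool :=
  [forall i, (0 < m i)%N ==> odd i].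

(* Only the first occurrence of each part size may be overlined, so an
   overpartition is a partition [x.1] together with the set [x.2] of those part
   sizes, among the ones that occur, whose first occurrence is overlined. *)
Definition is_overpartition (n : nat)
    (x : {ffun 'I_n.+1 -> 'I_n.+1} * {set 'I_n.+1}) : bool :=
  is_partition x.1 && [forall i, (i \in x.2) ==> (0 < x.1 i)%N].

Definition num_odd_overpartitions (n : nat) : nat :=
  #|[pred x : {ffun 'I_n.+1 -> 'I_n.+1} * {set 'I_n.+1} |
      is_overpartition x && has_odd_parts x.1]|.

Definition num_distinct_partitions (n : nat) : nat :=
  #|[pred m : {ffun 'I_n.+1 -> 'I_n.+1} |
      is_partition m && has_distinct_parts m]|.

(* Extension by zero to negative arguments. *)
Definition ext0 (f : nat -> nat) (z : int) : int :=
  if z is Posz n then Posz (f n) else 0%R.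

Definition po_bar : int -> int := ext0 num_odd_overpartitions.

Definition p_d : int -> int := ext0 num_distinct_partitions.

(* Main.v *)
Require Import Defs.
From mathcomp Require Import all_boot all_order all_algebra.
From mathcomp Require Import boolp classical_sets cardinality fsbigop.
From mathcomp Require Import zify ring.

Set Implicit Arguments.
Unset Strict Implicit.
Unset Printing Implicit Defensive.

Import GRing.Theory Num.Theory.

Local Open Scope classical_set_scope.
Local Open Scope ring_scope.

(** With [psi(-q) = sum_k (-1)^ceil(k/2) q^(k(k+1)/2)], the left-hand side has
    generating function [(-q;q^2) psi(-q) / (q;q^2)].  Gauss's identity
    [(-q;q^2) psi(-q) = (q^2;q^2)] turns it into [(q^2;q^2) / (q;q^2)], which by
    Euler's [(-q;q) (q;q^2) = 1] is [(-q;q) (q^2;q^2)], and the pentagonal number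
    theorem in [q^2] expands [(q^2;q^2)] as [sum_k (-1)^k q^(k(3k+1))].  Both theta
    expansions come from Shanks' finite identities, which hold for polynomials and
    reduce to the infinite products modulo a power of [q]. *)

(** * Congruence of polynomials modulo a power of the variable *)

Definition eqmodX (R : comNzRingType) (N : nat) (p q : {poly R}) : Prop :=
  forall i, (i < N)%N -> p`_i = q`_i.

Section EqmodX.
Variable R : comNzRingType.
Implicit Types (p q r : {poly R}) (N : nat).

Lemma eqmodX_refl N p : eqmodX N p p.
Proof. by []. Qed.

Lemma eqmodX_sym N p q : eqmodX N p q -> eqmodX N q p.
Proof. by move=> h i /h. Qed.

Lemma eqmodX_trans N p q r : eqmodX N p q -> eqmodX N q r -> eqmodX N p r.
Proof. by move=> h1 h2 i iN; rewrite h1 ?h2. Qed.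

Lemma eqmodX_le N N' p q : (N' <= N)%N -> eqmodX N p q -> eqmodX N' p q.
Proof. by move=> le h i iN; apply: h; apply: leq_trans le. Qed.

Lemma eqmodXD N p q p' q' :
  eqmodX N p p' -> eqmodX N q q' -> eqmodX N (p + q) (p' + q').
Proof. by move=> h1 h2 i iN; rewrite !coefD h1 ?h2. Qed.

Lemma eqmodXM N p q p' q' :
  eqmodX N p p' -> eqmodX N q q' -> eqmodX N (p * q) (p' * q').
Proof.
move=> h1 h2 i iN; rewrite !coefM; apply: eq_bigr => -[j /= ji] _.
by rewrite h1 ?h2 //; lia.
Qed.

Lemma eqmodXn0 N a p : (N <= a)%N -> eqmodX N (p * 'X^a) 0.
Proof. by move=> Na i iN; rewrite coefMXn coef0 (leq_trans iN Na). Qed.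

Lemma eqmodX_addXn N a p r : (N <= a)%N -> eqmodX N (p + r * 'X^a) p.
Proof.
move=> Na; rewrite -[X in eqmodX N _ X]addr0.
by apply: eqmodXD => //; apply: eqmodXn0.
Qed.

Lemma eqmodX_prod (I : Type) (s : seq I) (P : pred I) N (F G : I -> {poly R}) :
  (forall i, P i -> eqmodX N (F i) (G i)) ->
  eqmodX N (\prod_(i <- s | P i) F i) (\prod_(i <- s | P i) G i).
Proof. by move=> h; apply: big_ind2 => // *; apply: eqmodXM. Qed.

(** Factors congruent to 1 are invisible, so a long enough finite product stands for the infinite
    one. *)
Lemma eqmodX_prod_widen N m n (F : nat -> {poly R}) : (m <= n)%N ->
  (forall i, (m <= i)%N -> eqmodX N (F i) 1) ->
  eqmodX N (\prod_(0 <= i < n) F i) (\prod_(0 <= i < m) F i).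
Proof.
move=> mn h; rewrite (big_cat_nat (leq0n m) mn) //= -[X in eqmodX _ _ X]mulr1.
apply: eqmodXM => //; rewrite big_seq_cond.
apply: (big_ind (eqmodX N ^~ 1)) => // [p q hp hq|i].
  by rewrite -[X in eqmodX _ _ X]mulr1; apply: eqmodXM.
by rewrite mem_index_iota => /andP[/andP[+ _] _]; apply: h.
Qed.

(** The inverse is the geometric series in [1 - p], cut after [N] terms. As [1 - p] is a multiple of
    ['X], the error [(1 - p) ^+ N] vanishes modulo ['X^N]. *)
Lemma eqmodX_inverse N p : p`_0 = 1 -> exists q, eqmodX N (p * q) 1.
Proof.
move=> p0; exists (\sum_(i < N) (1 - p) ^+ i).
have -> : p * \sum_(i < N) (1 - p) ^+ i = 1 - (1 - p) ^+ N.
  by rewrite -[LHS]opprK -mulNr -[RHS]opprB subrX1; congr (- (_ * _)); ring.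
have -> : 1 - p = drop_poly 1 (1 - p) * 'X.
  rewrite -{1}(poly_take_drop 1 (1 - p)) expr1.
  suff -> : take_poly 1 (1 - p) = 0 by rewrite add0r.
  apply/polyP => -[|i]; rewrite coef_take_poly ?coef0 //=.
  by rewrite coefB coef1 p0 subrr.
by rewrite exprMn -mulNr; apply: eqmodX_addXn.
Qed.

Lemma eqmodX_cancel N (d p q : {poly R}) : d`_0 = 1 ->
  eqmodX N (d * p) (d * q) -> eqmodX N p q.
Proof.
move=> /(eqmodX_inverse N) [v dv] dpq.
have h r : eqmodX N (v * (d * r)) r.
  by rewrite mulrA [v * d]mulrC -[X in eqmodX _ _ X]mul1r; apply: eqmodXM.
by apply: eqmodX_trans (eqmodX_sym (h p)) (eqmodX_trans _ (h q)); apply: eqmodXM.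
Qed.

End EqmodX.

(** * Shanks' finite theta identities *)

Section Shanks.
Variables (R : comNzRingType) (q : R).

(** The quotient (q^2;q^2)_n / (q^2;q^2)_s of Shanks' sums, kept as a product to avoid division in
    [R]. *)
Definition even_tail (n s : nat) : R := \prod_(s.+1 <= k < n.+1) (1 - q ^+ (2 * k)).

(** This is (-cq;q^2)_n: [c = 1] gives the numerator of the overpartition series, [c = -1] its
    denominator. *)
Definition odd_prod (c : R) (n : nat) : R := \prod_(k < n) (1 + c * q ^+ (2 * k).+1).

Lemma even_tail_recl n s : (s < n)%N ->
  even_tail n s = (1 - q ^+ (2 * s.+1)) * even_tail n s.+1.
Proof. by move=> sn; rewrite /even_tail big_ltn. Qed.

Lemma even_tail_recr n s : (s <= n)%N ->
  even_tail n.+1 s = even_tail n s * (1 - q ^+ (2 * n.+1)).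
Proof. by move=> sn; rewrite /even_tail big_nat_recr. Qed.

Lemma even_tailnn n : even_tail n n = 1.
Proof. by rewrite /even_tail big_geq. Qed.

Lemma odd_prodS c n :
  odd_prod c n.+1 = odd_prod c n * (1 + c * q ^+ (2 * n).+1).
Proof. by rewrite /odd_prod big_ord_recr. Qed.

(** Summand of Shanks' pentagonal identity, with q^2 for q. *)
Definition pent_term (n s : nat) : R :=
  (-1) ^+ s * even_tail n s * q ^+ (s * (2 * n + s.+1)).

(** Induction on [m]: once [1 - q ^+ (2 * m.+1)] is split off [even_tail n m], the previous closed
    form cancels two of the three terms of the next difference. *)
Lemma pent_term_telescope n m : (m <= n)%N ->
  \sum_(s < m.+1) (pent_term n.+1 s - pent_term n s) =
  (-1) ^+ m.+1 * even_tail n m * q ^+ (m.+1 * (2 * n + m.+2)).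
Proof.
elim: m => [|m IHm] mn.
  rewrite big_ord1 /pent_term even_tail_recr // !mul0n !expr0 expr1 mul1n.
  have -> : (2 * n + 2 = 2 * n.+1)%N by lia.
  by ring.
rewrite big_ord_recr /= IHm ?(ltnW mn) // /pent_term even_tail_recr //.
rewrite (even_tail_recl mn).
have -> : (m.+1 * (2 * n.+1 + m.+2) = m.+1 * (2 * n + m.+2) + 2 * m.+1)%N by lia.
have -> : (m.+2 * (2 * n + m.+3) =
  m.+1 * (2 * n + m.+2) + 2 * m.+1 + 2 * n.+1)%N by lia.
rewrite (exprS _ m.+1).
move: (m.+1 * (2 * n + m.+2))%N (2 * m.+1)%N (2 * n.+1)%N => e f g.
move: (even_tail n m.+1) ((-1) ^+ m.+1) => r a.
by rewrite !(exprD q); ring.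
Qed.

Lemma pent_finite n :
  1 + \sum_(k < n) (-1) ^+ k.+1 *
        (q ^+ (k.+1 * (3 * k + 4)) + q ^+ (k.+1 * (3 * k + 2))) =
  \sum_(s < n.+1) pent_term n s.
Proof.
elim: n => [|n IHn].
  by rewrite big_ord0 big_ord1 /pent_term even_tailnn mul0n !expr0 addr0 !mulr1.
rewrite big_ord_recr /= addrA IHn [RHS]big_ord_recr /=.
have := pent_term_telescope (leqnn n); rewrite sumrB => /eqP.
rewrite subr_eq => /eqP ->.
rewrite /pent_term !even_tailnn.
(* The new exponents k(3k+1) at k = -(n+1) and k = n+1 come from the telescoped sum and from the
   added term [s = n.+1] respectively. *)
have -> : (n.+1 * (2 * n + n.+2) = n.+1 * (3 * n + 2))%N by lia.
have -> : (n.+1 * (2 * n.+1 + n.+2) = n.+1 * (3 * n + 4))%N by lia.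
by ring.
Qed.

(** Summand of Shanks' identity for Gauss's series, with -q for q and cleared of denominators by the
    multiplier (-q;q^2)_n. *)
Definition gauss_term (n s : nat) : R :=
  (-1) ^+ s * even_tail n s * odd_prod 1 s * q ^+ (s * (2 * n).+1).

(** The factor [1 + q ^+ (2 * n).+1] is the ratio of the multipliers at [n.+1] and [n]; with it the
    differences telescope as in the pentagonal case. *)
Lemma gauss_term_telescope n m : (m <= n)%N ->
  \sum_(s < m.+1) (gauss_term n.+1 s - (1 + q ^+ (2 * n).+1) * gauss_term n s) =
  (-1) ^+ m.+1 * even_tail n m * odd_prod 1 m.+1 * q ^+ (m.+1 * (2 * n).+1).
Proof.
elim: m => [|m IHm] mn.
  rewrite big_ord1 /gauss_term even_tail_recr // odd_prodS /odd_prod big_ord0.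
  rewrite !mul0n !expr0 !expr1 mul1n.
  have -> : (2 * n.+1 = (2 * n).+1 + 1)%N by lia.
  by rewrite !(exprD q) expr1; ring.
rewrite big_ord_recr /= IHm ?(ltnW mn) // /gauss_term even_tail_recr //.
rewrite (even_tail_recl mn) (odd_prodS _ m.+1).
have -> : (m.+1 * (2 * n.+1).+1 = m.+1 * (2 * n).+1 + 2 * m.+1)%N by lia.
have -> : (m.+2 * (2 * n).+1 = m.+1 * (2 * n).+1 + (2 * n).+1)%N by lia.
have -> : (2 * n.+1 = (2 * n).+1 + 1)%N by lia.
have -> : ((2 * m.+1).+1 = 2 * m.+1 + 1)%N by lia.
rewrite (exprS _ m.+1).
move: (m.+1 * (2 * n).+1)%N (2 * m.+1)%N (2 * n).+1 => e f g.
move: (even_tail n m.+1) ((-1) ^+ m.+1) (odd_prod 1 m.+1) => r a o.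
by rewrite !(exprD q) expr1; ring.
Qed.

Lemma gauss_finite n :
  odd_prod 1 n * \sum_(k < 2 * n) (-1) ^+ uphalf k * q ^+ (k * k.+1 %/ 2) =
  \sum_(s < n) gauss_term n s.
Proof.
elim: n => [|n IHn]; first by rewrite !big_ord0 mulr0.
rewrite -[(2 * n.+1)%N]/(n.+1 + (n.+1 + 0))%N addn0 addSnnS addnS.
have -> : (n + n.+1).+1 = (2 * n).+2 by lia.
rewrite !big_ord_recr /= odd_prodS.
have := gauss_term_telescope (leqnn n); rewrite sumrB -mulr_sumr => /eqP.
rewrite subr_eq [\sum_(i < n.+1) gauss_term n.+1 i]big_ord_recr /= => /eqP ->.
(* The sum for [n] stops before [s = n]. This extra term yields the triangular number of index
   [2 * n], the telescoped remainder that of index [(2 * n).+1]. *)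
rewrite [\sum_(i < n.+1) gauss_term n i]big_ord_recr /= -IHn /gauss_term.
rewrite !even_tailnn odd_prodS.
have -> : uphalf (2 * n) = n by lia.
have -> : (2 * n)./2.+1 = n.+1 by lia.
have -> : (2 * n * (2 * n).+1 %/ 2 = n * (2 * n).+1)%N by rewrite -mulnA mulKn.
have -> : ((2 * n).+1 * (2 * n).+2 %/ 2 = n.+1 * (2 * n).+1)%N.
  have -> : (2 * n).+2 = (2 * n.+1)%N by lia.
  by rewrite mulnCA mulKn // mulnC.
by rewrite exprS; ring.
Qed.

Lemma prod_double (F : nat -> R) n :
  \prod_(1 <= i < (2 * n).+1) F i =
  \prod_(k < n) F (2 * k).+1 * \prod_(1 <= k < n.+1) F (2 * k)%N.
Proof.
elim: n => [|n IHn]; first by rewrite !big_geq // big_ord0 mulr1.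
have -> : (2 * n.+1).+1 = (2 * n).+3 by lia.
rewrite [in LHS]big_nat_recr //= [in LHS]big_nat_recr //= IHn.
rewrite big_ord_recr /= [in RHS]big_nat_recr //=.
have -> : (2 * n.+1 = (2 * n).+2)%N by lia.
  by ring.
Qed.

Lemma prod_odd (F : nat -> R) n :
  \prod_(0 <= i < 2 * n | odd i) F i = \prod_(k < n) F (2 * k).+1.
Proof.
elim: n => [|n IHn]; first by rewrite big_geq // big_ord0.
have -> : (2 * n.+1 = (2 * n).+2)%N by lia.
rewrite big_ord_recr -IHn /= !(big_mkcond odd) !(@big_nat_recr _ _ _ _ 0) //=.
by rewrite oddM /= mulr1.
Qed.

End Shanks.

(** * Generating functions *)

(** Distributivity chooses a multiplicity for every [i], and [c i j] weighs the use of [i] exactly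
    [j] times. The index 0 adds nothing to the degree, so only [c 0] can constrain it. *)
Lemma coef_prod_partition (R : comNzRingType) (n : nat) (c : nat -> nat -> R) :
  (\prod_(i < n.+1) \sum_(j < n.+1) (c i j)%:P * 'X^(i * j))`_n =
  \sum_(m : {ffun 'I_n.+1 -> 'I_n.+1} | (\sum_(i < n.+1) i * m i)%N == n)
     \prod_(i < n.+1) c i (m i).
Proof.
rewrite bigA_distr_bigA coef_sum [RHS]big_mkcond /=; apply: eq_bigr => m _.
rewrite big_split /= -rmorph_prod /= -expr_sum coefCM coefXn eq_sym.
by case: eqP; rewrite ?mulr1 ?mulr0.
Qed.

Lemma prod_natr_bool (R : comNzRingType) (I : finType) (b : pred I) :
  \prod_(i : I) (b i)%:R = [forall i, b i]%:R :> R.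
Proof.
case: forallP => [h|/forallP]; first by apply: big1 => i _; rewrite h.
by rewrite negb_forall => /existsP[i /negbTE bi]; rewrite (bigD1 i) //= bi mul0r.
Qed.

Lemma num_distinct_partitionsE (n : nat) :
  (num_distinct_partitions n)%:Z =
  (\prod_(1 <= i < n.+1) (1 + 'X^i) : {poly int})`_n.
Proof.
(* The second conjunct forces multiplicity 0 on the index 0, whose factor becomes 1. *)
pose c (i j : nat) : int := ((j <= 1)%N && ((i == 0%N) ==> (j == 0%N)))%:R.
have -> : \prod_(1 <= i < n.+1) (1 + 'X^i) =
    \prod_(i < n.+1) \sum_(j < n.+1) (c i j)%:P * 'X^(i * j) :> {poly int}.
  rewrite big_ord_recl /= big_add1 /= big_mkord.
  rewrite [X in _ = X * _]big_ord_recl /= [X in _ + X]big1 => [|j _]; last first.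
    by rewrite /c /= andbF mul0r.
  rewrite addr0 /c /= !mul1r ?mul0n ?expr0 ?mul1r; apply: eq_bigr => i _.
  case: n i => [[]//|n] i.
  rewrite !big_ord_recl big1 => [|j _]; last by rewrite /c /= mul0r.
  by rewrite /c /= !mul1r muln0 muln1 addr0 expr0.
rewrite coef_prod_partition /num_distinct_partitions -sum1_card.
rewrite -[LHS]natz natr_sum big_mkcond [RHS]big_mkcond /=; apply: eq_bigr => m _.
rewrite prod_natr_bool inE /is_partition /has_distinct_parts.
case: (_ == n); rewrite /= ?andbF // andbT -val_eqE /=.
suff -> : [forall i, (m i <= 1)%N && ((val i == 0%N) ==> (val (m i) == 0%N))] =
    (val (m ord0) == 0%N) && [forall i, (m i <= 1)%N] by case: (_ && _).
apply/forallP/andP => [h|[m0 /forallP h] i].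
  split; first by have /andP[_] := h ord0; rewrite eqxx.
  by apply/forallP => i; have /andP[] := h i.
by rewrite h /=; apply/implyP => i0; rewrite (_ : i = ord0) //; apply/val_inj/eqP.
Qed.

(** Each factor truncates (1 + q^i)/(1 - q^i) = 1 + 2q^i + 2q^(2i) + ...; the 2 records whether the
    first occurrence is overlined. *)
Definition odd_over_poly (n : nat) : {poly int} :=
  \prod_(0 <= i < n.+1 | odd i) (1 + \sum_(j < n) 2%:P * 'X^(i * j.+1)).

Lemma num_odd_overpartitionsE (n : nat) :
  (num_odd_overpartitions n)%:Z = (odd_over_poly n)`_n.
Proof.
pose c (i j : nat) : int := if j == 0%N then 1 else if odd i then 2 else 0.
have -> : odd_over_poly n =
    \prod_(i < n.+1) \sum_(j < n.+1) (c i j)%:P * 'X^(i * j).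
  rewrite /odd_over_poly big_mkcond big_mkord; apply: eq_bigr => i _.
  rewrite big_ord_recl /c /= mul1r muln0 expr0; case: (odd i) => //.
  by rewrite big1 ?addr0 // => j _; rewrite mul0r.
rewrite coef_prod_partition /num_odd_overpartitions -sum1_card.
(* For fixed multiplicities the overlined sets are the subsets of the support, whose number is the
   product of the weights 2 in [c]. *)
rewrite (eq_bigl (fun x : {ffun 'I_n.+1 -> 'I_n.+1} * {set 'I_n.+1} =>
  (is_partition x.1 && has_odd_parts x.1) &&
  (x.2 \in powerset [set i | (0 < x.1 i)%N]%SET))); last first.
  move=> [m S]; rewrite !inE /is_overpartition /= andbAC; congr (_ && _).
  apply/forallP/fintype.subsetP => h i; last by apply/implyP => /h; rewrite inE.
  by move=> iS; rewrite inE; have := h i; rewrite iS.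
rewrite -(pair_big_dep (fun m => is_partition m && has_odd_parts m)
  (fun m S => S \in powerset [set i | (0 < m i)%N]%SET) (fun _ _ => 1%N)) /=.
rewrite -[LHS]natz natr_sum big_mkcond [RHS]big_mkcond /=; apply: eq_bigr => m _.
rewrite sum1_card card_powerset /is_partition.
case: (_ == n); rewrite /= ?andbF // andbT.
have [ho|] := boolP (has_odd_parts m).
  have -> : m ord0 == ord0.
    by move/forallP/(_ ord0): ho; rewrite /= implybF -val_eqE /=; case: (val _).
  rewrite /= natrX -prodr_const [LHS]big_mkcond /=; apply: eq_bigr => i _.
  move/forallP/(_ i): ho; rewrite inE /c; case: (val (m i)) => //= k.
  by move->.
rewrite andbF negb_forall => /existsP[i].
rewrite negb_imply => /andP[mi /negbTE oi].
by rewrite (bigD1 i) //= /c oi gtn_eqF // mul0r.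
Qed.

Lemma odd_prod_eqmodX (j M : nat) (c : {poly int}) : (j < 2 * M)%N ->
  eqmodX j.+1 (odd_prod 'X c M) (\prod_(0 <= i < j.+1 | odd i) (1 + c * 'X^i)).
Proof.
move=> jM; rewrite -[odd_prod _ _ _](prod_odd (fun i => 1 + c * 'X^i)).
rewrite !(big_mkcond odd); apply: eqmodX_prod_widen => // i ji.
by case: (odd i) => //; apply: eqmodX_addXn.
Qed.

Lemma odd_over_poly_eqmodX (j M : nat) : (j < 2 * M)%N ->
  eqmodX j.+1 (odd_over_poly j * odd_prod 'X (-1) M) (odd_prod 'X 1 M).
Proof.
move=> jM.
apply: eqmodX_trans (eqmodXM (@eqmodX_refl _ _ _) (odd_prod_eqmodX _ jM)) _.
apply: eqmodX_trans (eqmodX_sym (odd_prod_eqmodX _ jM)).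
rewrite /odd_over_poly -big_split /=; apply: eqmodX_prod => i oi.
(* The geometric sum telescopes; at [m = j] the error exponent [i * j.+1] exceeds [j] because an odd
   [i] is positive. *)
have -> m : (1 + \sum_(k < m) 2%:P * 'X^(i * k.+1)) * (1 + -1 * 'X^i) =
    1 + 1 * 'X^i + (- 2) * 'X^(i * m.+1) :> {poly int}.
  elim: m => [|m IHm]; first by rewrite big_ord0 muln1; ring.
  rewrite big_ord_recr /= addrA mulrDl IHm (mulnS i m.+1) exprD.
  by rewrite (_ : 2%:P = 2) ?rmorph_nat //; ring.
by apply: eqmodX_addXn; case: i oi => // i _; rewrite leq_pmull.
Qed.

(** Here [V] plays the part of 1/(q;q^2), so that one polynomial serves all [j] at once. *)
Lemma num_odd_overpartitions_coef (N M : nat) (V : {poly int}) :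
  eqmodX N (odd_prod 'X (-1) M * V) 1 ->
  forall j, (j < N)%N -> (j < 2 * M)%N ->
  (num_odd_overpartitions j)%:Z = (odd_prod 'X 1 M * V)`_j.
Proof.
move=> DV j jN jM; rewrite num_odd_overpartitionsE.
have DVj := eqmodX_le jN DV.
suff h : eqmodX j.+1 (odd_over_poly j) (odd_prod 'X 1 M * V) by apply: h.
apply: eqmodX_trans (eqmodXM (odd_over_poly_eqmodX jM) (@eqmodX_refl _ _ V)).
rewrite -mulrA -[X in eqmodX _ X]mulr1; apply: eqmodXM => //.
exact: eqmodX_sym.
Qed.

Lemma num_distinct_partitions_coef (j K : nat) : (j <= K)%N ->
  (num_distinct_partitions j)%:Z =
  (\prod_(1 <= i < K.+1) (1 + 'X^i) : {poly int})`_j.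
Proof.
move=> jK; rewrite num_distinct_partitionsE !big_add1 /=.
apply: (eqmodX_sym (N := j.+1)) => //; apply: eqmodX_prod_widen => // i ji.
by rewrite -['X^_]mul1r; apply: eqmodX_addXn.
Qed.

(** * Infinite products modulo a power of the variable *)

(** The sum of (-1)^k q^(k(3k+1)) over |k| <= M, with k and -k paired. *)
Definition pent_poly (M : nat) : {poly int} :=
  1 + \sum_(k < M) (-1) ^+ k.+1 *
        ('X^(k.+1 * (3 * k + 4)) + 'X^(k.+1 * (3 * k + 2))).

Definition tri_poly (M : nat) : {poly int} :=
  \sum_(k < 2 * M) (-1) ^+ uphalf k * 'X^(k * k.+1 %/ 2).

(** Only [s = 0] survives in Shanks' sum: every other summand carries a power of ['X] of exponent at
    least [M]. *)
Lemma pent_poly_eqmodX (M : nat) :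
  eqmodX M (pent_poly M) (even_tail 'X M 0).
Proof.
rewrite /pent_poly pent_finite big_ord_recl /= {1}/pent_term mul0n !expr0 mulr1.
rewrite mul1r -[X in eqmodX _ _ X]addr0; apply: eqmodXD => //.
apply: (big_ind (fun p => eqmodX M p 0)) => // [p r hp hr|s _].
  by rewrite -[X in eqmodX _ _ X]addr0; apply: eqmodXD.
by apply: eqmodXn0; rewrite /bump /=; nia.
Qed.

Lemma tri_poly_eqmodX (M : nat) :
  eqmodX M (odd_prod 'X 1 M * tri_poly M) (even_tail 'X M 0).
Proof.
(* At [M = 0] Shanks' sum has no term [s = 0], but the congruence is vacuous. *)
case: M => // M; rewrite /tri_poly gauss_finite big_ord_recl /= {1}/gauss_term.
rewrite mul0n !expr0 mulr1 mul1r {1}/odd_prod big_ord0 mulr1.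
rewrite -[X in eqmodX _ _ X]addr0; apply: eqmodXD => //.
apply: (big_ind (fun p => eqmodX M.+1 p 0)) => // [p r hp hr|s _].
  by rewrite -[X in eqmodX _ _ X]addr0; apply: eqmodXD.
by apply: eqmodXn0; rewrite /bump /=; nia.
Qed.

(** Euler's identity, multiplied by (q^2;q^2)_M: this completes (q;q^2)_M to (q;q)_{2M}, and then (1
    - q^i)(1 + q^i) = 1 - q^(2i) applies factor by factor. *)
Lemma distinct_prod_eqmodX (M : nat) :
  eqmodX M (odd_prod 'X (-1) M * \prod_(1 <= i < (2 * M).+1) (1 + 'X^i)
              * even_tail 'X M 0) (even_tail 'X M 0 : {poly int}).
Proof.
have -> : odd_prod 'X (-1) M * \prod_(1 <= i < (2 * M).+1) (1 + 'X^i)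
    * even_tail 'X M 0 = even_tail 'X (2 * M) 0 :> {poly int}.
  rewrite mulrAC.
  have -> : odd_prod 'X (-1) M * even_tail 'X M 0 =
      \prod_(1 <= i < (2 * M).+1) (1 - 'X^i) :> {poly int}.
    rewrite prod_double; congr (_ * _).
    by apply: eq_bigr => k _; rewrite mulN1r.
  rewrite -big_split /=; apply: eq_bigr => i _.
  by rewrite mulnC exprM; ring.
rewrite /even_tail !big_add1 /=; apply: eqmodX_prod_widen => [|i Mi]; first by lia.
by rewrite -mulN1r; apply: eqmodX_addXn; lia.
Qed.

Lemma odd_prod_coef0 (M : nat) (c : {poly int}) : (odd_prod 'X c M)`_0 = 1.
Proof.
rewrite -horner_coef0 horner_prod big1 // => k _.
by rewrite !hornerE expr0n /= mulr0 addr0.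
Qed.

(** After multiplication by (q;q^2)_M both sides become (q^2;q^2)_M, the left one by Gauss, the
    right one by Euler and the pentagonal number theorem. *)
Lemma theta_eqmodX (M : nat) (V : {poly int}) :
  eqmodX M (odd_prod 'X (-1) M * V) 1 ->
  eqmodX M (odd_prod 'X 1 M * V * tri_poly M)
           (\prod_(1 <= i < (2 * M).+1) (1 + 'X^i) * pent_poly M).
Proof.
move=> DV; apply: (eqmodX_cancel (odd_prod_coef0 M (-1))).
apply: (@eqmodX_trans _ _ _ (even_tail 'X M 0)).
  rewrite -[X in eqmodX _ _ X]mul1r.
  have -> : odd_prod 'X (-1) M * (odd_prod 'X 1 M * V * tri_poly M) =
    (odd_prod 'X (-1) M * V) * (odd_prod 'X 1 M * tri_poly M) by ring.
  by apply: eqmodXM => //; apply: tri_poly_eqmodX.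
apply: eqmodX_trans (eqmodX_sym (@distinct_prod_eqmodX M)) _.
rewrite mulrA; apply: eqmodXM => //; apply: eqmodX_sym.
exact: pent_poly_eqmodX.
Qed.

(** * Extraction of coefficients *)

Lemma ext0_sub (f : nat -> nat) (A : {poly int}) (n t : nat) :
  (forall j, (j <= n)%N -> (f j)%:Z = A`_j) ->
  ext0 f (n%:Z - t%:Z) = (A * 'X^t)`_n.
Proof.
move=> fA; rewrite coefMXn; case: ltnP => nt; last by rewrite subzn //= fA ?leq_subr.
have -> : n%:Z - t%:Z = Negz (t - n).-1 by lia.
by [].
Qed.

Lemma coef_signM (R : nzRingType) (p : {poly R}) (k i : nat) :
  ((-1) ^+ k * p)`_i = (-1) ^+ k * p`_i.
Proof.
rewrite -signr_odd -[(-1) ^+ k in RHS]signr_odd.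
by case: (odd k); rewrite ?expr1 ?expr0 ?mulN1r ?mul1r ?coefN.
Qed.

(** Each step adds a pair of opposite integers ([Negz M'] is -(M'+1)), in parallel with the pairs of
    [pent_poly]. *)
Fixpoint int_ball (M : nat) : seq int :=
  if M is M'.+1 then Posz M'.+1 :: Negz M' :: int_ball M' else [:: 0].

Lemma mem_int_ball (M : nat) (k : int) : (k \in int_ball M) = (`|k| <= M)%N.
Proof.
elim: M => [|M IHM] /=; first by rewrite inE; lia.
by rewrite !inE IHM; lia.
Qed.

Lemma int_ball_uniq (M : nat) : uniq (int_ball M).
Proof. by elim: M => //= M ->; rewrite inE !mem_int_ball; lia. Qed.

Lemma fsum_nat_widen (m : nat) (F : nat -> int) :
  (forall k, (m <= k)%N -> F k = 0) ->
  \sum_(k \in [set: nat]) F k = \sum_(k < m) F k.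
Proof.
move=> F0; rewrite fsbig_ord; apply/esym/fsbig_widen => // k [_ /= /negP].
by rewrite -leqNgt; apply: F0.
Qed.

Lemma fsum_int_widen (m : nat) (F : int -> int) :
  (forall k : int, (m < `|k|)%N -> F k = 0) ->
  \sum_(k \in [set: int]) F k = \sum_(k <- int_ball m) F k.
Proof.
move=> F0; rewrite [RHS]fsbig_seq ?int_ball_uniq //.
apply/esym/fsbig_widen => // k [_ /= /negP].
by rewrite mem_int_ball -ltnNge; apply: F0.
Qed.

Lemma sum_int_ball_pent (f : nat -> nat) (A : {poly int}) (n M : nat) :
  (forall j, (j <= n)%N -> (f j)%:Z = A`_j) ->
  \sum_(k <- int_ball M) (-1) ^ k * ext0 f (n%:Z - k * (3 * k + 1)) =
  (A * pent_poly M)`_n.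
Proof.
move=> fA; elim: M => [|M IHM].
  by rewrite big_seq1 mul1r mul0r subr0 /pent_poly big_ord0 addr0 mulr1 /= fA.
rewrite !big_cons IHM /pent_poly big_ord_recr /= [in RHS]addrA [in RHS]mulrDr coefD.
rewrite [RHS]addrC addrA; congr (_ + _).
have -> : Posz M.+1 * (3 * Posz M.+1 + 1) = (M.+1 * (3 * M + 4))%N%:Z by lia.
have -> : Negz M * (3 * Negz M + 1) = (M.+1 * (3 * M + 2))%N%:Z by lia.
rewrite !(ext0_sub _ fA) -[(-1) ^ Posz _]/((-1) ^+ M.+1).
(* A sign is its own inverse, so both members of the pair carry the same sign. *)
rewrite -[(-1) ^ Negz _]/((-1) ^- M.+1) invr_sign -mulrDr -coefD -mulrDr.
by rewrite [in RHS]mulrCA coef_signM.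
Qed.

Lemma ext0_neg (f : nat -> nat) (z : int) : z < 0 -> ext0 f z = 0.
Proof. by case: z. Qed.

(* [uphalf k] is the ceiling of k/2.  [\sum_(k \in A)] is the sum of a finitely
   supported family; here all but finitely many arguments are negative. *)
Theorem theorem3p13 (n : nat) :
  \sum_(k \in [set: nat])
     (-1) ^+ uphalf k * po_bar (n%:Z - ((k * k.+1) %/ 2)%N%:Z)
  = \sum_(k \in [set: int])
     (-1) ^ k * p_d (n%:Z - k * (3 * k + 1)).
Proof.
(* Precision [n.+1] is what reading the coefficient of index [n] takes. *)
have [V DV] := eqmodX_inverse n.+1 (odd_prod_coef0 n.+1 (-1)).
rewrite (@fsum_nat_widen (2 * n.+1)) => [|k nk]; last first.
  rewrite /po_bar ext0_neg ?mulr0 // subr_lt0 ltz_nat.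
  by rewrite leq_divRL //; nia.
rewrite (@fsum_int_widen n.+1) => [|k nk]; last first.
  by rewrite /p_d ext0_neg ?mulr0 //; nia.
rewrite (sum_int_ball_pent
  (A := \prod_(1 <= i < (2 * n.+1).+1) (1 + 'X^i))); last first.
  by move=> j jn; apply: num_distinct_partitions_coef; lia.
rewrite -(theta_eqmodX DV (ltnSn n)) mulr_sumr coef_sum; apply: eq_bigr => k _.
rewrite /po_bar (@ext0_sub _ (odd_prod 'X 1 n.+1 * V)) => [|j jn]; last first.
  by apply: (num_odd_overpartitions_coef DV); lia.
by rewrite [in RHS]mulrCA coef_signM.
Qed.
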